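(* Let $d$ be a real number such that $0\le d\le 1/2$. Then there is a sequence of permutations $\pi_n\in S_n$ such that $\lim_{n\to\infty}\mathrm{d}(\pi_n)/n=d$.
   Context: $S_n$ is the set of all permutations of $\{1,\dots,n\}$. For $\pi\in S_n$ the displacement of $\pi$ is $\mathrm{d}(\pi)=\frac1n\sum_{i=1}^n|i-\pi(i)|$. *)

(* Defs.v *)
From mathcomp Require Import all_boot all_order all_algebra all_fingroup.
From mathcomp Require Import all_classical all_reals all_analysis.
Set Implicit Arguments.
Unset Strict Implicit.
Unset Printing Implicit Defensive.
Import Order.TTheory GRing.Theory Num.Theory numFieldNormedType.Exports.
Local Open Scope ring_scope.

(* 'S_n permutes {0, ..., n-1} instead of {1, ..., n}; shifting both i and s i
   by 1 leaves every |i - s i| unchanged. For n = 0 the value is 0. *)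
Definition displacement (R : realType) (n : nat) (s : 'S_n) : R :=
  n%:R^-1 * \sum_(i < n) `|(i : nat)%:R - (s i : nat)%:R : R|.

(* Main.v *)
(* The rotation i |-> i + k mod n moves n - k points by k and k points by n - k,
   so its displacement divided by n is 2 (k/n) (1 - k/n). Taking k = floor (a n)
   gives the limit 2 a (1 - a), which equals d for a = (1 - sqrt (1 - 2 d)) / 2. *)
Require Import Defs.
From mathcomp Require Import all_boot all_order all_algebra all_fingroup.
From mathcomp Require Import all_classical all_reals all_analysis.
From mathcomp Require Import ring lra.
Import Order.TTheory GRing.Theory Num.Theory numFieldNormedType.Exports.
Local Open Scope classical_set_scope.
Local Open Scope ring_scope.

(** Addition in ['I_m.+1] is modulo [m.+1], so cancellation in this group gives injectivity. As
    [inord k] defaults to 0 once [k > m], the lemmas below assume [k <= m]. *)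
Definition rotation (n : nat) : nat -> 'S_n :=
  match n with
  | 0 => fun=> 1%g
  | m.+1 => fun k => perm (@addIr 'I_m.+1 (inord k))
  end.

Lemma rotationE (m k : nat) (i : 'I_m.+1) :
  (k <= m)%N -> rotation m.+1 k i = ((i + k) %% m.+1)%N :> nat.
Proof. by move=> km; rewrite permE /= inordK. Qed.

Lemma displacement_rotation (R : realType) (m k : nat) : (k <= m)%N ->
  displacement R (rotation m.+1 k) / m.+1%:R =
  2 * (k%:R / m.+1%:R) * (1 - k%:R / m.+1%:R).
Proof.
move=> km; have kn : (k <= m.+1)%N by exact: leqW.
have -> : displacement R (rotation m.+1 k) =
    m.+1%:R^-1 * (2 * k%:R * (m.+1%:R - k%:R)).
  rewrite /displacement; congr (_ * _).
  under eq_bigr do rewrite rotationE//.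
  rewrite -(big_mkord xpredT
    (fun i => `|i%:R - ((i + k) %% m.+1)%:R : R|)).
  (* The cut is at the first index whose image wraps around. *)
  rewrite (@big_cat_nat _ _ _ (m.+1 - k))//= ?leq_subr//.
  rewrite (@eq_big_nat _ _ _ 0%N _ _ (fun=> k%:R)); last first.
    move=> i; rewrite ltn_subRL addnC => /= ik.
    by rewrite modn_small// natrD opprD addNKr normrN normr_nat.
  rewrite (@eq_big_nat _ _ _ (m.+1 - k)%N _ _ (fun=> (m.+1 - k)%:R)); last first.
    move=> i /andP[]; rewrite leq_subLR addnC => ik im.
    (* Here [i + k] lies in [[m.+1, 2 * m.+1)], so reduction subtracts [m.+1] exactly once. *)
    have -> : ((i + k) %% m.+1)%N = (i + k - m.+1)%N.
      rewrite -{1}(subnK ik) modnDr modn_small// ltn_subLR//.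
      by rewrite -addSn leq_add.
    have -> : i%:R - (i + k - m.+1)%:R = (m.+1 - k)%:R :> R.
      by rewrite !natrB// natrD; ring.
    by rewrite normr_nat.
  by rewrite !sumr_const_nat subn0 subKn// -(mulr_natr k%:R)
    -(mulr_natr _ k) natrB//; ring.
have n0 : m.+1%:R != 0 :> R by rewrite pnatr_eq0.
by move: (m.+1%:R) n0 => n n0; field.
Qed.

(** Truncation loses less than 1, so the ratio is squeezed between [a - 1 / n.+1] and [a]. *)
Lemma cvg_truncn_ratio (R : realType) (a : R) : 0 <= a ->
  (Num.truncn (a * n.+1%:R))%:R / n.+1%:R @[n --> \oo] --> a.
Proof.
move=> a0; have an n : 0 <= a * n.+1%:R by rewrite mulr_ge0.
apply: (@squeeze_cvgr _ _ _ _ (fun n => a - harmonic n) (fun=> a)).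
- near=> n; apply/andP; split.
  + rewrite ler_pdivlMr// mulrBl mulVf// lerBlDr natr1.
    by rewrite ltW// truncnS_gt.
  + by rewrite ler_pdivrMr// truncn_le.
- rewrite -[X in _ --> X]subr0; apply: cvgB; first exact: cvg_cst.
  exact: cvg_harmonic.
- exact: cvg_cst.
Unshelve. all: by end_near.
Qed.

Theorem proposition2p7 (R : realType) (d : R) (hd : 0 <= d <= 1 / 2) :
  exists p : forall n : nat, 'S_n,
    displacement R (p n) / n%:R @[n --> \oo] --> d.
Proof.
case/andP: hd => d0 d1.
pose s : R := Num.sqrt (1 - 2 * d).
have s2 : s ^+ 2 = 1 - 2 * d by rewrite sqr_sqrtr//; lra.
have s0 : 0 <= s := sqrtr_ge0 _.
have s1 : s <= 1 by rewrite -(@ler_pXn2r _ 2)// ?nnegrE// s2; lra.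
(* The smaller root of [2 * x * (1 - x) = d]: it stays at most 1/2, whereas the larger one reaches 1
   when [d = 0]. *)
pose a := (1 - s) / 2.
have a0 : 0 <= a by rewrite /a; lra.
have a1 : a < 1 by rewrite /a; lra.
have -> : d = 2 * a * (1 - a).
  have -> : d = (1 - s ^+ 2) / 2 by rewrite s2; field.
  by rewrite /a; field.
exists (fun n => rotation n (Num.truncn (a * n%:R))).
(* Dropping the term [n = 0] leaves only nonzero denominators. *)
rewrite -cvg_shiftS /=.
rewrite [X in X @ _](_ : _ = fun n : nat =>
  2 * ((Num.truncn (a * n.+1%:R))%:R / n.+1%:R) *
  (1 - (Num.truncn (a * n.+1%:R))%:R / n.+1%:R)); last first.
  (* The condition [k <= m] holds because [a < 1] keeps the truncation of [a * n.+1] strictly below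
     [n.+1]. *)
  apply/funext => n; rewrite displacement_rotation// -ltnS -(ltr_nat R).
  apply: (@le_lt_trans _ _ (a * n.+1%:R)); first by rewrite truncn_le// mulr_ge0.
  by rewrite gtr_pMl.
have ca := cvg_truncn_ratio R a a0.
apply: cvgM; first by apply: cvgM ca; exact: cvg_cst.
by apply: cvgB ca; exact: cvg_cst.
Qed.
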